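(* Let $G$ be a finite abelian group and $Y\subset G$ a non-empty subset. Then the following conditions are equivalent. (1) $Y$ is a difference set or $Y=G$. (2) $\partial_\rho(Y)$ is independent of the choice of $\rho\in\widehat{G}\setminus\{1_G\}$. (3) Equality holds in the inequality $\displaystyle D(Y)\ge\sqrt{\frac{1/\#Y-1/\#G}{\#G-1}}$.
   Context: For $a\in G$ let $\lambda_a:=\#\{(x,y)\in Y\times Y\mid x^{-1}y=a\}$. A non-empty proper subset $Y$ of $G$ is a (difference set, more precisely a) $(v,k,\lambda)$-difference set if $v=\#G$, $k=\#Y$ and $\lambda_a=\lambda$ for every $a\in G$ except $a=1$. $\widehat{G}$ is the set of isomorphism classes of irreducible complex representations of $G$; $\chi_\rho$ and $\dim\rho$ denote the character and dimension of $\rho\in\widehat G$ (here $\dim\rho=1$ since $G$ is abelian); $1_G$ is the trivial representation. For $\rho\in\widehat{G}$, $$\partial_\rho(Y):=\sqrt{\frac{\dim\rho}{(\#Y)^2\,\#G}\sum_{x,y\in Y}\chi_\rho(x^{-1}y)},$$ where the quantity under the square root is a non-negative real number, and $D(Y):=\max_{\rho\in\widehat{G}\setminus\{1_G\}}\frac{\partial_\rho(Y)}{\dim\rho}$. *)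

(* Defs.v *)
From HB Require Import structures.
From mathcomp Require Import all_boot all_order all_algebra all_fingroup.
From mathcomp Require Import all_solvable all_field all_character.

Set Implicit Arguments.
Unset Strict Implicit.
Unset Printing Implicit Defensive.

Import Order.TTheory GroupScope GRing.Theory Num.Theory.
Local Open Scope ring_scope.

Definition ndiff (gT : finGroupType) (Y : {set gT}) (a : gT) : nat :=
  #|[set p in setX Y Y | (p.1^-1 * p.2)%g == a]|.

Definition is_difference_set (gT : finGroupType) (G Y : {set gT})
    (v k l : nat) : Prop :=
  [/\ Y != set0, Y \proper G, v = #|G|, k = #|Y|
    & forall a, a \in G -> a != 1%g -> ndiff Y a = l].

Definition difference_set (gT : finGroupType) (G Y : {set gT}) : Prop :=
  exists v k l : nat, is_difference_set G Y v k l.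

(* Complex representations are taken over algC, which loses nothing for a     *)
(* finite group: Iirr G indexes the isomorphism classes of irreducible        *)
(* representations, 'chi_rho is the character, 'chi_rho 1 the dimension, and  *)
(* rho = 0 the trivial representation. The argument of sqrtC is a nonnegative *)
(* real whenever Y \subset G, and sqrtC is then its nonnegative root.         *)
Definition partial_norm (gT : finGroupType) (G : {group gT}) (Y : {set gT})
    (rho : Iirr G) : algC :=
  sqrtC ('chi_rho 1%g / (#|Y|%:R ^+ 2 * #|G|%:R)
         * \sum_(x in Y) \sum_(y in Y) 'chi_rho (x^-1 * y)%g).

(* algC is only partially ordered, but the values compared are nonnegative    *)
(* reals when Y \subset G, so that this is their maximum, starting from 0;    *)
(* for the trivial group, which has no nontrivial rho, it is 0.               *)
Definition discrepancy (gT : finGroupType) (G : {group gT}) (Y : {set gT})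
    : algC :=
  \big[Num.max/0]_(rho : Iirr G | rho != 0)
     (partial_norm Y rho / 'chi_rho 1%g).

(* Main.v *)
Require Import Defs.
From HB Require Import structures.
From mathcomp Require Import all_boot all_order all_algebra all_fingroup.
From mathcomp Require Import all_solvable all_field all_character.
From mathcomp Require Import ring.

Set Implicit Arguments.
Unset Strict Implicit.
Unset Printing Implicit Defensive.

Import Order.TTheory GroupScope GRing.Theory Num.Theory.
Local Open Scope ring_scope.

(** The statement is Fourier duality on [G] between two functions: the
    difference count [a |-> ndiff Y a] on [G] and its Fourier transform
    [rho |-> P rho := sum_(x, y in Y) chi_rho (x^-1 y)
                    = |sum_(y in Y) chi_rho y|^2] on the dual group
    ([spectral_power_ndiff], [spectral_power_inversion]).
    A function on an abelian group is constant off the identity exactly when it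
    is a constant plus a multiple of the indicator of the identity, and the
    Fourier transform exchanges constants with multiples of that indicator; so
    one of the two functions is constant off the identity iff the other one is
    ([flat_ndiff_spectral_power], [flat_spectral_power_ndiff]). Constancy of
    [ndiff Y] off [1] is being a difference set or the whole group
    ([difference_set_or_group]). Since dimensions are 1, [partial_norm Y rho] is
    the square root of [P rho] up to a positive factor independent of [rho], so
    constancy of [P] off the trivial character is the second condition.

    For the third condition, let [k] and [v] be the cardinals of [Y] and [G].
    The value of the inversion formula at [1] gives
    [sum_rho P rho = v k], while [P 0 = k^2]; hence the mean of the squares of
    [partial_norm Y rho] over the [v - 1] nontrivial [rho] is always
    [(1 / k - 1 / v) / (v - 1)] ([sum_mean_sqr_partial_norm]). The discrepancy
    is the largest of these norms, and a maximum equals the mean iff all terms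
    are equal ([bigmax_const], [sum_le_eq]). *)

(** * Maxima and means of nonnegative families *)

Lemma bigmax_ge0 (R : numDomainType) (I : Type) (r : seq I) (P : pred I)
    (F : I -> R) :
  (forall i, P i -> 0 <= F i) -> 0 <= \big[Num.max/0]_(i <- r | P i) F i.
Proof.
move=> F0; apply: (big_ind (fun x => 0 <= x)) => // x y x0 y0.
by rewrite /Order.max; case: ifP.
Qed.

(** In a partially ordered number domain [Num.max] is not an upper bound in
    general; nonnegativity makes all the values compared real. *)
Lemma le_bigmax_nneg (R : numDomainType) (I : finType) (P : pred I)
    (F : I -> R) (j : I) :
  (forall i, P i -> 0 <= F i) -> P j ->
  F j <= \big[Num.max/0]_(i | P i) F i.
Proof.
move=> F0; move: (mem_index_enum j).
elim: (index_enum I) => // i r IHr; rewrite inE big_cons => jr Pj.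
have M0 := bigmax_ge0 r F0; set M := bigop _ _ _ in M0 IHr *.
case: (boolP (P i)) => [Pi | nPi]; last first.
  by case/predU1P: jr => [ji | /IHr->//]; rewrite -ji Pj in nPi.
have cmp : F i >=< M by apply: real_comparable; apply: ger0_real; rewrite ?F0.
rewrite comparable_le_max //.
by case/predU1P: jr => [-> | /IHr->//]; rewrite ?lexx ?orbT.
Qed.

Lemma bigmax_const (R : numDomainType) (I : finType) (P : pred I)
    (F : I -> R) (c : R) (j : I) :
  0 <= c -> P j -> (forall i, P i -> F i = c) ->
  \big[Num.max/0]_(i | P i) F i = c.
Proof.
move=> c0 Pj Fc; apply/le_anti/andP; split; last first.
  by rewrite -{1}(Fc j Pj) le_bigmax_nneg // => i /Fc->.
apply: (big_ind (fun x => x <= c)) => // [x y xc yc | i /Fc->//].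
by rewrite /Order.max; case: ifP.
Qed.

(** The equality of sums says that [c] is the mean of [F], without dividing by
    the number of indices, so that an empty family is covered too. *)
Lemma sum_le_eq (R : numDomainType) (I : finType) (P : pred I)
    (F : I -> R) (c : R) :
  (forall i, P i -> F i <= c) -> \sum_(i | P i) F i = \sum_(i | P i) c ->
  forall i, P i -> F i = c.
Proof.
move=> Fc /eqP sumF i Pi.
have /leif_sum[_] : forall i, P i -> F i <= c ?= iff (F i == c).
  by move=> j Pj; split; first exact: Fc.
by rewrite sumF => /esym/forallP/(_ i); rewrite Pi => /eqP.
Qed.

(** * Difference counts and their Fourier transform *)

Definition spectral_power (gT : finGroupType) (G : {group gT}) (Y : {set gT})
    (rho : Iirr G) : algC :=
  \sum_(x in Y) \sum_(y in Y) 'chi_rho (x^-1 * y)%g.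

Section DifferenceCounts.

Variables (gT : finGroupType) (G : {group gT}) (Y : {set gT}).
Hypothesis sYG : Y \subset G.

Lemma ndiff1 : ndiff Y 1%g = #|Y|.
Proof.
rewrite /ndiff -(card_imset _ (_ : injective (fun x : gT => (x, x)))).
  apply: eq_card => -[x y]; rewrite !inE /=.
  apply/idP/imsetP => [/andP[/andP[xY yY]] | [z zY [-> ->]]]; last first.
    by rewrite zY mulVg eqxx.
  by rewrite -eq_mulVg1 => /eqP <-; exists x.
by move=> x y [].
Qed.

Lemma ndiff_group a : a \in G -> ndiff G a = #|G|.
Proof.
move=> aG; rewrite /ndiff.
rewrite -(card_imset _ (_ : injective (fun x => (x, x * a)%g))).
  apply: eq_card => -[x y]; rewrite !inE /=.
  apply/idP/imsetP => [/andP[/andP[xG yG] /eqP <-] | [z zG [-> ->]]].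
    by exists x; rewrite ?mulKVg.
  by rewrite zG groupM // mulKg eqxx.
by move=> x y [].
Qed.

(** Properness in the definition of a difference set excludes only [Y = G],
    for which the counts are constant as well. *)
Lemma difference_set_or_group :
  Y != set0 ->
  difference_set G Y \/ Y = G <->
  exists l, forall a, a \in G -> a != 1%g -> ndiff Y a = l.
Proof.
move=> Yn0; split=> [[[v [k [l []]]] | ->] | [l Yl]].
- by exists l.
- by exists #|G| => a aG _; apply: ndiff_group.
have [-> | YG] := eqVneq Y G; [by right | left].
by exists #|G|, #|Y|, l; split; rewrite // properEneq YG.
Qed.

Lemma spectral_power_ndiff (rho : Iirr G) :
  spectral_power Y rho = \sum_(a in G) (ndiff Y a)%:R * 'chi_rho a.
Proof.
rewrite /spectral_power pair_big /=.
rewrite (partition_big (fun p => (p.1^-1 * p.2)%g) (mem G)) /=; last first.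
  by case=> x y /andP[xY yY]; rewrite groupM ?groupV //= (subsetP sYG).
apply: eq_bigr => a _.
rewrite (eq_bigr (fun=> 'chi_rho a)) => [|p /andP[_ /eqP <-] //].
rewrite sumr_const mulr_natl /ndiff; congr (_ *+ _).
by apply: eq_card => -[x y]; rewrite !inE.
Qed.

Lemma sum_irr_nontrivial (rho : Iirr G) :
  rho != 0 -> \sum_(a in G) 'chi_rho a = 0.
Proof.
move=> rho0; have /eqP := first_orthogonality_relation rho 0.
rewrite (negPf rho0) mulf_eq0 invr_eq0 (negPf (neq0CG G)) /= => /eqP sum0.
rewrite -[RHS]sum0; apply: eq_bigr => a aG.
by rewrite irr0 cfun1E groupV aG mulr1.
Qed.

Lemma spectral_power_trivial : spectral_power Y (0 : Iirr G) = #|Y|%:R ^+ 2.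
Proof.
rewrite /spectral_power (eq_bigr (fun=> #|Y|%:R)) => [|x xY].
  by rewrite sumr_const -[LHS]mulr_natr.
rewrite (eq_bigr (fun=> 1)) ?sumr_const // => y yY.
by rewrite irr0 cfun1E groupM ?groupV // (subsetP sYG).
Qed.

Hypothesis abelG : abelian G.

(** The linear character turns the double sum into a square modulus. *)
Lemma spectral_power_ge0 (rho : Iirr G) : 0 <= spectral_power Y rho.
Proof.
have lin := char_abelianP _ abelG rho.
have -> : spectral_power Y rho = `|\sum_(y in Y) 'chi_rho y| ^+ 2.
  rewrite normCK mulrC rmorph_sum /= mulr_suml; apply: eq_bigr => x xY.
  rewrite mulr_sumr; apply: eq_bigr => y yY.
  by rewrite lin_charM ?lin_charV_conj ?groupV ?(subsetP sYG).
exact: exprn_ge0.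
Qed.

(** Column orthogonality, where conjugacy classes are singletons and
    centralisers are the whole group. *)
Lemma sum_irr_mul_conj (a b : gT) :
  a \in G -> b \in G ->
  \sum_(rho : Iirr G) 'chi_rho a * ('chi_rho b)^* = #|G|%:R *+ (a == b).
Proof.
move=> aG bG; rewrite second_orthogonality_relation //.
rewrite (abelian_classP _ abelG) // inE.
suff /eqP-> : ('C_G[a])%g == G by [].
rewrite eqEsubset subsetIl subsetI subxx /= sub_cent1.
exact: subsetP abelG a aG.
Qed.

Lemma spectral_power_inversion (a : gT) :
  a \in G ->
  \sum_(rho : Iirr G) spectral_power Y rho * ('chi_rho a)^*
    = #|G|%:R * (ndiff Y a)%:R.
Proof.
move=> aG; under eq_bigr do rewrite spectral_power_ndiff mulr_suml.
rewrite exchange_big /=.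
transitivity (\sum_(b in G) (ndiff Y b)%:R * (#|G|%:R *+ (b == a)) : algC).
  apply: eq_bigr => b bG; rewrite -(sum_irr_mul_conj bG aG) mulr_sumr.
  by apply: eq_bigr => rho _; rewrite mulrA.
rewrite (bigD1 a) //= eqxx mulrC big1 ?addr0 // => b /andP[_ /negPf->].
by rewrite mulr0.
Qed.

(** Parseval: inversion at [1], minus the contribution of the trivial
    character. *)
Lemma sum_spectral_power_nontrivial :
  \sum_(rho : Iirr G | rho != 0) spectral_power Y rho
    = #|G|%:R * #|Y|%:R - #|Y|%:R ^+ 2.
Proof.
have chi1 rho : ('chi[G]_rho 1%g)^* = 1.
  by rewrite (lin_char1 (char_abelianP _ abelG rho)) rmorph1.
have := spectral_power_inversion (group1 G); rewrite ndiff1 => <-.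
under [in RHS]eq_bigr do rewrite chi1 mulr1.
rewrite [in RHS](bigD1 (0 : Iirr G)) //= spectral_power_trivial.
by rewrite [RHS]addrC addKr.
Qed.

(** A nontrivial character sums to 0 over [G], hence to [-1] off the identity,
    where the count is [l]; the identity contributes [#|Y|]. *)
Lemma flat_ndiff_spectral_power (l : nat) (rho : Iirr G) :
  (forall a, a \in G -> a != 1%g -> ndiff Y a = l) -> rho != 0 ->
  spectral_power Y rho = #|Y|%:R - l%:R.
Proof.
move=> Yl rho0; rewrite spectral_power_ndiff.
have chi1 := lin_char1 (char_abelianP _ abelG rho).
have /eqP := sum_irr_nontrivial rho0.
rewrite (bigD1 1%g) //= chi1 addr_eq0 => /eqP sum1.
rewrite (bigD1 1%g) //= chi1 ndiff1 mulr1; congr (_ + _).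
under eq_bigr => a /andP[aG a1] do rewrite Yl //.
by rewrite -mulr_sumr -[X in _ * X]opprK -sum1 mulrN1.
Qed.

(** Dual to the previous lemma: for [a] other than [1] the values at [a] of the
    nontrivial characters sum to [-1], and the trivial one contributes
    [#|Y|^2]. *)
Lemma flat_spectral_power_ndiff (c : algC) (a : gT) :
  (forall rho : Iirr G, rho != 0 -> spectral_power Y rho = c) ->
  a \in G -> a != 1%g ->
  (ndiff Y a)%:R = (#|Y|%:R ^+ 2 - c) / #|G|%:R.
Proof.
move=> Yc aG a1; apply: (mulfI (neq0CG G)).
rewrite -spectral_power_inversion // mulrCA divff ?neq0CG // mulr1.
have chi0 : ('chi_(0 : Iirr G) a)^* = 1 by rewrite irr0 cfun1E aG rmorph1.
have := sum_irr_mul_conj (group1 G) aG; rewrite eq_sym (negPf a1) mulr0n.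
under eq_bigr => rho _ do
  rewrite (lin_char1 (char_abelianP _ abelG rho)) mul1r.
rewrite (bigD1 (0 : Iirr G)) //= chi0 addrC => /eqP.
rewrite addr_eq0 => /eqP sum0.
rewrite (bigD1 (0 : Iirr G)) //= chi0 mulr1 spectral_power_trivial.
under eq_bigr => rho rho0 do rewrite Yc //.
by rewrite -mulr_sumr sum0 mulrN1.
Qed.

(** * The mean of the squared norms *)

Lemma card_nontrivial_irr : #|[pred rho : Iirr G | rho != 0]| = #|G|.-1.
Proof. by rewrite -(card_Iirr_abelian abelG) -(cardC1 (0 : Iirr G)). Qed.

Hypothesis Yn0 : Y != set0.

Lemma partial_norm_spectral_power (rho : Iirr G) :
  partial_norm Y rho
    = sqrtC (spectral_power Y rho / (#|Y|%:R ^+ 2 * #|G|%:R)).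
Proof.
by rewrite /partial_norm (lin_char1 (char_abelianP _ abelG rho)) mul1r mulrC.
Qed.

Lemma partial_norm_ge0 (rho : Iirr G) : 0 <= partial_norm Y rho.
Proof.
rewrite partial_norm_spectral_power sqrtC_ge0 divr_ge0 ?spectral_power_ge0 //.
by rewrite mulr_ge0 ?exprn_ge0 ?ler0n.
Qed.

Lemma discrepancyE :
  discrepancy G Y
    = \big[Num.max/0]_(rho : Iirr G | rho != 0) partial_norm Y rho.
Proof.
apply: eq_bigr => rho _.
by rewrite (lin_char1 (char_abelianP _ abelG rho)) divr1.
Qed.

Lemma sum_sqr_partial_norm :
  \sum_(rho : Iirr G | rho != 0) partial_norm Y rho ^+ 2
    = #|Y|%:R^-1 - #|G|%:R^-1.
Proof.
under eq_bigr do rewrite partial_norm_spectral_power sqrtCK.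
rewrite -mulr_suml sum_spectral_power_nontrivial.
have k0 : #|Y|%:R != 0 :> algC by rewrite pnatr_eq0 cards_eq0.
have v0 := neq0CG G.
by field; rewrite k0 v0.
Qed.

Definition mean_sqr_partial_norm : algC :=
  (#|Y|%:R^-1 - #|G|%:R^-1) / (#|G|%:R - 1).

(** For the trivial group the mean is a division by 0, but both sums are
    empty. *)
Lemma sum_mean_sqr_partial_norm :
  \sum_(rho : Iirr G | rho != 0) partial_norm Y rho ^+ 2
    = \sum_(rho : Iirr G | rho != 0) mean_sqr_partial_norm.
Proof.
have [/card0_eq irrP | v1] := posnP #|[pred rho : Iirr G | rho != 0]|.
  by rewrite !big_pred0.
rewrite sum_sqr_partial_norm sumr_const card_nontrivial_irr.
rewrite card_nontrivial_irr in v1.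
rewrite -[RHS]mulr_natr /mean_sqr_partial_norm -subn1 natrB ?cardG_gt0 //.
rewrite divfK //.
by rewrite subr_eq0 pnatr_eq1 -(prednK (cardG_gt0 G)) eqSS -lt0n.
Qed.

End DifferenceCounts.

Theorem theorem4 (gT : finGroupType) (G : {group gT}) (Y : {set gT})
    (abelG : abelian G) (sYG : Y \subset G) (Yn0 : Y != set0) :
  [<-> (* (1) *) difference_set G Y \/ Y = G;
       (* (2) *) forall rho sigma : Iirr G, rho != 0 -> sigma != 0 ->
                   partial_norm Y rho = partial_norm Y sigma;
       (* (3) *) discrepancy G Y =
                   sqrtC ((#|Y|%:R^-1 - #|G|%:R^-1) / (#|G|%:R - 1))].
Proof.
have sum_m := sum_mean_sqr_partial_norm sYG abelG Yn0.
rewrite -/(mean_sqr_partial_norm G Y).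
set m := mean_sqr_partial_norm G Y in sum_m *.
tfae.
- case/(difference_set_or_group sYG Yn0) => l Yl rho sigma rho0 sigma0.
  rewrite !partial_norm_spectral_power //.
  by rewrite !(flat_ndiff_spectral_power _ _ Yl).
- rewrite discrepancyE // => pnC.
  have [rho rho0 | irr1] := pickP [pred rho : Iirr G | rho != 0]; last first.
    have v1 : #|G| = 1%N.
      by rewrite -(prednK (cardG_gt0 G)) -card_nontrivial_irr // eq_card0.
    (* Over the trivial group both sides are 0, as the inverse of 0 is 0. *)
    rewrite big_pred0 // /m /mean_sqr_partial_norm v1.
    by rewrite subrr invr0 mulr0 sqrtC0.
  have pn0 := partial_norm_ge0 sYG abelG rho.
  suff -> : m = partial_norm Y rho ^+ 2.
    rewrite sqrCK //; apply: (bigmax_const pn0 rho0) => sigma sigma0.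
    exact: pnC.
  have := sum_m; under eq_bigr => sigma sigma0 do rewrite (pnC _ rho) //.
  rewrite !sumr_const => /eqP; rewrite eqrMn2r => /predU1P[|/eqP //].
  by move/card0_eq/(_ rho); rewrite [LHS]rho0.
- rewrite discrepancyE // => Dm; apply/(difference_set_or_group sYG Yn0).
  have pn2 (rho : Iirr G) : rho != 0 -> partial_norm Y rho ^+ 2 = m.
    move: rho; apply: sum_le_eq sum_m => rho rho0; rewrite -[m]sqrtCK -Dm.
    have pn0 sigma := partial_norm_ge0 sYG abelG sigma.
    by rewrite lerXn2r ?le_bigmax_nneg // nnegrE ?bigmax_ge0.
  have Yc (rho : Iirr G) : rho != 0 ->
      spectral_power Y rho = m * (#|Y|%:R ^+ 2 * #|G|%:R).
    move=> /pn2 <-; rewrite partial_norm_spectral_power // sqrtCK divfK //.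
    by rewrite mulf_neq0 ?expf_neq0 ?neq0CG // pnatr_eq0 cards_eq0.
  have flat := flat_spectral_power_ndiff sYG abelG Yc.
  have [b /andP[bG b1] | G1] := pickP [pred a in G | a != 1%g].
    (* [flat] gives the common value in [algC] only; a value at some [b] makes
       it a natural number. *)
    exists (ndiff Y b) => a aG a1.
    by apply/eqP; rewrite -(eqr_nat algC) !flat.
  by exists 0%N => a aG a1; have := G1 a; rewrite /= aG a1.
Qed.
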